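(* Let $A$ be a finite set and let $\Gamma_1$ be a valued constraint language on $A$, i.e. a finite set of functions $\varrho:A^k\to[0,1]$ (with $k$ depending on $\varrho$). For each $\varrho\in\Gamma_1$ of arity $k$ let $R_\varrho=\{\mathbf a\in A^k \mid \varrho(\mathbf a)=0\}$, and let $\Gamma_2=\{R_\varrho \mid \varrho\in\Gamma_1\}$. Then $\mathrm{VCSP}(\Gamma_1)$ belongs to $\mathrm{APX}$ if and only if $\mathrm{MinCSP}(\Gamma_2)$ belongs to $\mathrm{APX}$.
   Context: An instance of $\mathrm{VCSP}(\Gamma_1)$ consists of a finite set $V$ of variables and a finite list of constraints $C=(\mathbf v,\varrho)$ where $\varrho\in\Gamma_1$ is $k$-ary, $\mathbf v\in V^k$, each with a weight $w_C\in\mathbb Q_{>0}$; the goal is to find an assignment $s:V\to A$ minimizing $\sum_C w_C\,\varrho(s(\mathbf v))$ ($s$ applied componentwise). For a constraint language $\Gamma$ (finite set of relations on $A$), an instance of $\mathrm{MinCSP}(\Gamma)$ consists of a finite set $V$ of variables and a finite list of weighted constraints $C=(\mathbf v,R)$ with $R\in\Gamma$ of arity $k$, $\mathbf v\in V^k$, $w_C\in\mathbb Q_{>0}$; the goal is to find $s:V\to A$ minimizing the total weight of constraints with $s(\mathbf v)\notin R$. A problem is in $\mathrm{APX}$ if it admits a polynomial-time constant-factor approximation algorithm, i.e. one that for some constant $c$ always returns an assignment of value at most $c$ times the optimum. *)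

(* Defs.v *)
From HB Require Import structures.
From Corelib Require Import PosDef.
From mathcomp Require Import all_boot all_order all_algebra finmap reals.

Set Implicit Arguments.
Unset Strict Implicit.
Unset Printing Implicit Defensive.

Import Order.TTheory GRing.Theory Num.Theory.
Local Open Scope fset_scope.
Local Open Scope ring_scope.

Variant move := MoveL | MoveR | Stay.

(* Tape cells hold [None] (the blank), an input/output symbol [inl a], or an
   auxiliary work symbol [inr b]. *)
Record machine (Sigma : finType) := Machine {
  state : finType;
  work : finType;
  start : state;
  halted : pred state;
  delta : state -> option (Sigma + work) ->
          state * option (Sigma + work) * move }.

Section Run.
Variables (Sigma : finType) (M : machine Sigma).

Definition cell := option (Sigma + work M).

(* [left] is the part of the tape strictly to the left of the head, nearest
   cell first; [right] starts with the scanned cell.  Cells beyond either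
   sequence are blank. *)
Record config := Config { cstate : state M; left : seq cell; right : seq cell }.

Definition init (x : seq Sigma) : config :=
  Config (start M) [::] [seq Some (inl a) | a <- x].

Definition step (c : config) : config :=
  if halted (cstate c) then c else
  let: (q, b, d) := delta (cstate c) (head None (right c)) in
  let r := behead (right c) in
  match d with
  | MoveL => Config q (behead (left c)) (head None (left c) :: b :: r)
  | MoveR => Config q (b :: left c) r
  | Stay => Config q (left c) (b :: r)
  end.

(* The output is the longest word over [Sigma] that starts at the head. *)
Fixpoint read (t : seq cell) : seq Sigma :=
  if t is Some (inl a) :: t' then a :: read t' else [::].

(* [step] fixes halted configurations, so this says that [M] halts on [x]
   after at most [t] steps, with output [y]. *)
Definition outputs_within (t : nat) (x y : seq Sigma) : Prop :=
  let c := iter t step (init x) in halted (cstate c) /\ read (right c) = y.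

End Run.

Record min_problem (R : realType) := MinProblem {
  alphabet : finType;
  instance : Type;
  solution : instance -> Type;
  encode_instance : instance -> seq alphabet;
  encode_solution : forall I, solution I -> seq alphabet;
  value : forall I, solution I -> R }.

Definition optimal (R : realType) (P : min_problem R) (I : instance P)
    (s : solution I) : Prop :=
  forall s' : solution I, value s <= value s'.

Definition APX (R : realType) (P : min_problem R) : Prop :=
  exists (M : machine (alphabet P)) (p : {poly nat}) (c : R),
  forall I : instance P, exists s : solution I,
    outputs_within M p.[size (encode_instance I)]
      (encode_instance I) (encode_solution s) /\
    forall s_opt : solution I, optimal s_opt -> value s <= c * value s_opt.

(* The first component is the arity. *)
Definition relation (A : finType) := {k : nat & {set k.-tuple A}}.
Definition cost_function (R : realType) (A : finType) :=
  {k : nat & {ffun k.-tuple A -> R}}.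

HB.instance Definition _ (A : finType) := Choice.on (relation A).
HB.instance Definition _ (R : realType) (A : finType) :=
  Choice.on (cost_function R A).

Definition is_valued_language (R : realType) (A : finType)
    (G : {fset cost_function R A}) : Prop :=
  forall f, f \in G -> forall a : (tag f).-tuple A, 0 <= tagged f a <= 1.

Definition zero_relation (R : realType) (A : finType)
    (f : cost_function R A) : relation A :=
  Tagged (fun k => {set k.-tuple A})
         [set a : (tag f).-tuple A | tagged f a == 0].

Definition zero_language (R : realType) (A : finType)
    (G : {fset cost_function R A}) : {fset relation A} :=
  [fset zero_relation f | f in G].

Record wconstraint (S : finType) (ar : S -> nat) (n : nat) := WConstraint {
  symbol : S;
  scope : (ar symbol).-tuple 'I_n;
  weight : rat;
  weight_gt0 : 0 < weight }.

Record csp_instance (S : finType) (ar : S -> nat) := CspInstance {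
  nvars : nat;
  constraints : seq (wconstraint ar nvars) }.

Definition assignment (S A : finType) (ar : S -> nat) (I : csp_instance ar) :=
  {ffun 'I_(nvars I) -> A}.

Inductive letter (S A : Type) :=
  Symbol of S | Value of A | Bit of bool | Tick | Sep | Slash.
Arguments Tick {S A}.
Arguments Sep {S A}.
Arguments Slash {S A}.
Arguments Symbol {S A}.
Arguments Value {S A}.
Arguments Bit {S A}.

Section LetterFinite.
Variables S A : Type.
Definition letter_code (l : letter S A) : S + A + bool + option bool :=
  match l with
  | Symbol f => inl (inl (inl f)) | Value a => inl (inl (inr a))
  | Bit b => inl (inr b)
  | Tick => inr None | Sep => inr (Some false) | Slash => inr (Some true)
  end.
Definition letter_decode (c : S + A + bool + option bool) : letter S A :=
  match c with
  | inl (inl (inl f)) => Symbol f | inl (inl (inr a)) => Value a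
  | inl (inr b) => Bit b
  | inr None => Tick | inr (Some false) => Sep | inr (Some true) => Slash
  end.
Lemma letter_codeK : cancel letter_code letter_decode.
Proof. by case. Qed.
End LetterFinite.

HB.instance Definition _ (S A : finType) :=
  Finite.copy (letter S A) (can_type (@letter_codeK S A)).

Section Encoding.
Variables S A : finType.

(* Binary notation, least significant bit first; 0 is the empty word. *)
Fixpoint pos_bits (p : positive) : seq bool :=
  match p with
  | xH => [:: true]
  | xO p' => false :: pos_bits p'
  | xI p' => true :: pos_bits p'
  end.
Definition nat_bits (n : nat) : seq (letter S A) :=
  if bin_of_nat n is Npos p then [seq Bit b | b <- pos_bits p] else [::].

Variable ar : S -> nat.

Definition encode_constraint n (C : wconstraint ar n) : seq (letter S A) :=
  Symbol (symbol C)
    :: flatten [seq Sep :: nat_bits (i : 'I_n) | i <- scope C]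
    ++ Sep :: nat_bits `|numq (weight C)|%N
    ++ Slash :: nat_bits `|denq (weight C)|%N.

(* One [Tick] per variable, then the constraints; only the names of the
   variables and the weights are in binary, so the size is at least |V|. *)
Definition encode_csp (I : csp_instance ar) : seq (letter S A) :=
  nseq (nvars I) Tick
    ++ flatten [seq encode_constraint C | C <- constraints I].

Definition encode_assignment (I : csp_instance ar) (s : assignment A I) :
    seq (letter S A) :=
  [seq Value (s i) | i <- enum 'I_(nvars I)].

End Encoding.

Section Problems.
Variables (R : realType) (A : finType).

Section VCSP.
Variable G : {fset cost_function R A}.
Definition cost_arity (f : G) : nat := tag (val f).

Definition vcsp_value (I : csp_instance cost_arity) (s : assignment A I) : R :=
  \sum_(C <- constraints I)
    ratr (weight C) * tagged (val (symbol C)) (map_tuple s (scope C)).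

Definition VCSP : min_problem R :=
  MinProblem (@encode_csp G A cost_arity) (@encode_assignment G A cost_arity)
    vcsp_value.
End VCSP.

Section MinCSP.
Variable G : {fset relation A}.
Definition rel_arity (r : G) : nat := tag (val r).

Definition mincsp_value (I : csp_instance rel_arity) (s : assignment A I) : R :=
  \sum_(C <- constraints I |
        map_tuple s (scope C) \notin tagged (val (symbol C)))
    ratr (weight C).

Definition MinCSP : min_problem R :=
  MinProblem (@encode_csp G A rel_arity) (@encode_assignment G A rel_arity)
    mincsp_value.
End MinCSP.

End Problems.

(* Main.v *)
Require Import Defs.
From mathcomp Require Import all_boot all_order all_algebra finmap reals.

(** Let [e > 0] be the least nonzero value taken by a cost function of the
    language.  Replacing each cost function by its zero relation changes the
    value of an assignment by a factor between [e] and [1], so the two problems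
    have the same approximate solutions up to a constant.  In both directions
    the translation of instances renames the constraint symbols one letter at a
    time, so a Turing machine for one problem yields a machine for the other
    that renames the letters as it scans them, with no overhead in time. *)

Set Implicit Arguments.
Unset Strict Implicit.
Unset Printing Implicit Defensive.

Import Order.TTheory GRing.Theory Num.Theory.
Local Open Scope ring_scope.

Section Simulation.
Variables (Sigma1 Sigma2 W : finType) (M : machine Sigma2).
Variables (dec : option (Sigma1 + W) -> cell M).
Variables (enc : cell M -> option (Sigma1 + W)).
Hypotheses (encK : cancel enc dec) (dec_blank : dec None = None).

(** Each cell of [M] is stored as a code: [dec] reads any code, [enc] picks the one to write. A cell
    may have several codes, so input letters need no translation beforehand. *)
Definition recode_machine : machine Sigma1 :=
  @Machine Sigma1 (state M) W (start M) (@halted _ M)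
    (fun q c => let: (q', b, d) := delta q (dec c) in (q', enc b, d)).

Definition decode_config (c : config recode_machine) : config M :=
  @Config _ M (cstate c) (map dec (left c)) (map dec (right c)).

Lemma head_map_dec (t : seq (cell recode_machine)) :
  head None (map dec t) = dec (head None t).
Proof. by case: t => /=. Qed.

(** Written cells decode correctly by [encK], and the blanks beyond the stored sequences stay blank
    by [dec_blank]. *)
Lemma decode_step (c : config recode_machine) :
  decode_config (step c) = step (decode_config c).
Proof.
rewrite /step /=; case: ifP => // _.
rewrite head_map_dec; case: delta => [[q b] []] /=;
  by rewrite /decode_config /= ?head_map_dec ?encK ?behead_map.
Qed.

Lemma decode_iter_step n (c : config recode_machine) :
  decode_config (iter n (@step _ _) c) = iter n (@step _ _) (decode_config c).
Proof. by elim: n => //= n <-; rewrite decode_step. Qed.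

(** The first hypothesis makes [f1 x] the only code of the output letter [f2 x]. By the second,
    letters of [Sigma1] decode to letters of [Sigma2], so both words end at the same cell. *)
Lemma read_recode (T : Type) (f1 : T -> Sigma1) (f2 : T -> Sigma2) :
    (forall x c, dec c = Some (inl (f2 x)) -> c = Some (inl (f1 x))) ->
    (forall a, exists a', dec (Some (inl a)) = Some (inl a')) ->
  forall (t : seq (cell recode_machine)) (s : seq T),
  read (map dec t) = map f2 s -> read t = map f1 s.
Proof.
move=> f2K dec_inl; elim=> [|c t IHt] [|x s] //=.
  case: c => [[a|w]|] //=; by have [a' ->] := dec_inl a.
case Dc: (dec c) => [[a|w]|] //= [Da Dt]; rewrite Da in Dc.
by rewrite (f2K _ _ Dc) /= (IHt s Dt).
Qed.

Lemma recode_outputs (T : Type) (f1 : T -> Sigma1) (f2 : T -> Sigma2)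
    (phi : Sigma1 -> Sigma2) n x s :
    (forall y c, dec c = Some (inl (f2 y)) -> c = Some (inl (f1 y))) ->
    (forall a, dec (Some (inl a)) = Some (inl (phi a))) ->
  outputs_within M n (map phi x) (map f2 s) ->
  outputs_within recode_machine n x (map f1 s).
Proof.
move=> f2K decE; rewrite /outputs_within.
have -> : init M (map phi x) = decode_config (init recode_machine x).
  by rewrite /init /decode_config /= -!map_comp; congr Config;
     apply: eq_map => a /=; rewrite decE.
rewrite -decode_iter_step; case=> halt_c out_c; split; first exact: halt_c.
by apply: read_recode out_c => // a; exists (phi a); rewrite decE.
Qed.

End Simulation.

Section Relabel.
Variables (R : realType) (A S1 S2 : finType) (ar1 : S1 -> nat) (ar2 : S2 -> nat).
Variables (phi : S1 -> S2) (ar_phi : forall f, ar1 f = ar2 (phi f)).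

Definition relabel_constraint n (C : wconstraint ar1 n) : wconstraint ar2 n :=
  @WConstraint S2 ar2 n (phi (symbol C)) (tcast (ar_phi _) (scope C))
    (weight C) (weight_gt0 C).

Definition relabel (I : csp_instance ar1) : csp_instance ar2 :=
  CspInstance (map (@relabel_constraint (nvars I)) (constraints I)).

Definition relabel_letter (l : letter S1 A) : letter S2 A :=
  match l with
  | Symbol f => Symbol (phi f)
  | Value a => Value a | Bit b => Bit b
  | Tick => Tick | Sep => Sep | Slash => Slash
  end.

Lemma relabel_nat_bits n :
  map relabel_letter (nat_bits S1 A n) = nat_bits S2 A n.
Proof. by rewrite /nat_bits; case: bin_of_nat => //= p; rewrite -map_comp. Qed.

Lemma encode_relabel (I : csp_instance ar1) :
  encode_csp A (relabel I) = map relabel_letter (encode_csp A I).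
Proof.
rewrite /encode_csp map_cat map_nseq map_flatten -!map_comp; congr (_ ++ flatten _).
apply: eq_map => C /=.
rewrite /encode_constraint /= !map_cat map_flatten /= map_cat /= !relabel_nat_bits.
rewrite val_tcast -map_comp; congr (_ :: flatten _ ++ _).
by apply: eq_map => i /=; rewrite relabel_nat_bits.
Qed.

Section Machine.
Variable M : machine (letter S2 A).

Definition relabel_decode (c : option (letter S1 A + (letter S2 A + work M))) :
    cell M :=
  match c with
  | None => None
  | Some (inl l) => Some (inl (relabel_letter l))
  (* Junk: [relabel_encode] never writes this cell, and decoding it to the
     blank leaves [inl (Value a)] as the only code of the output letter. *)
  | Some (inr (inl (Value _))) => None
  | Some (inr (inl l)) => Some (inl l)
  | Some (inr (inr w)) => Some (inr w)
  end.

(** Since [phi] need not be onto, a [Symbol] written by [M] may have no counterpart over [S1]; the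
    work alphabet therefore contains a copy of [letter S2 A]. Only [Value] letters, which form the
    output, are written as themselves. *)
Definition relabel_encode (c : cell M) :
    option (letter S1 A + (letter S2 A + work M)) :=
  match c with
  | None => None
  | Some (inl (Value a)) => Some (inl (Value a))
  | Some (inl l) => Some (inr (inl l))
  | Some (inr w) => Some (inr (inr w))
  end.

Lemma relabel_encodeK : cancel relabel_encode relabel_decode.
Proof. by case=> [[[]|]|]. Qed.

Lemma relabel_decode_Value a c :
  relabel_decode c = Some (inl (Value a)) -> c = Some (inl (Value a)).
Proof. by case: c => [[[]|[[]|]]|] //= b [->]. Qed.

End Machine.

(** [I] and [relabel I] have the same assignments and encodings of equal length, so the answer for
    [relabel I] is returned for [I], with the same polynomial. *)
Lemma APX_relabel (v1 : forall I : csp_instance ar1, assignment A I -> R)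
    (v2 : forall I : csp_instance ar2, assignment A I -> R) (a b : R) :
    0 <= a -> (forall I s, 0 <= v2 I s) ->
    (forall I s, v1 I s <= a * v2 (relabel I) s) ->
    (forall I s, v2 (relabel I) s <= b * v1 I s) ->
  APX (MinProblem (@encode_csp S2 A ar2) (@encode_assignment S2 A ar2) v2) ->
  APX (MinProblem (@encode_csp S1 A ar1) (@encode_assignment S1 A ar1) v1).
Proof.
move=> a_ge0 v2_ge0 v1_le v2_le [M [p [c approx]]].
(* The sign of [c] is unknown; its absolute value lets inequalities be multiplied by it. *)
exists (recode_machine (@relabel_decode M) (@relabel_encode M)), p, (a * (`|c| * b)).
move=> I; have [s [out_s le_s]] := approx (relabel I).
exists s; split.
  have := out_s; rewrite /= encode_relabel size_map.
  apply: (recode_outputs (@relabel_encodeK M)) => //.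
  by move=> i d; apply: relabel_decode_Value.
move=> s1 _.
(* The guarantee for [M] refers to an optimum of [relabel I]; it exists because the assignments form
   a finite set containing [s]. *)
have [s2 s2_opt] : exists s2, forall t, v2 (relabel I) s2 <= v2 (relabel I) t.
  exists [arg min_(t < s) v2 (relabel I) t]%O => t.
  by case: arg_minP => //= s2 _; apply.
rewrite -!mulrA; apply: le_trans (v1_le I s) _; apply: ler_wpM2l => //.
apply: le_trans (le_s s2 s2_opt) _.
apply: le_trans (ler_wpM2r (v2_ge0 _ _) (ler_norm c)) _.
apply: ler_wpM2l; first exact: normr_ge0.
exact: le_trans (s2_opt s1) (v2_le I s1).
Qed.

End Relabel.

Lemma positive_values_bounded_below (R : realType) (T : finType) (F : T -> R) :
  exists2 e : R, 0 < e & forall x, 0 < F x -> e <= F x.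
Proof.
(* The seed [1] keeps the minimum positive when [F] has no positive value. *)
exists (\big[Num.min/1]_(x | 0 < F x) F x).
  by elim/big_ind: _ => // x y x_gt0 y_gt0; rewrite lt_min x_gt0.
by move=> x Fx_gt0; apply: bigmin_le_cond.
Qed.

Section Values.
Variables (R : realType) (A : finType).

Lemma mincsp_valueE (G : {fset relation A}) (I : csp_instance (@rel_arity A G))
    (s : assignment A I) :
  mincsp_value R s = \sum_(C <- constraints I) ratr (weight C) *
    (map_tuple s (scope C) \notin tagged (val (symbol C)))%:R.
Proof.
rewrite /mincsp_value big_mkcond; apply: eq_bigr => C _.
by case: ifP; rewrite ?mulr1 ?mulr0.
Qed.

Lemma ratr_weight_ge0 (S : finType) (ar : S -> nat) n (C : wconstraint ar n) :
  0 <= ratr (weight C) :> R.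
Proof. by rewrite ler0q ltW ?weight_gt0. Qed.

Lemma mincsp_value_ge0 (G : {fset relation A})
    (I : csp_instance (@rel_arity A G)) (s : assignment A I) :
  0 <= mincsp_value R s.
Proof. by apply: sumr_ge0 => C _; apply: ratr_weight_ge0. Qed.

Lemma vcsp_value_ge0 (G : {fset cost_function R A})
    (hG : is_valued_language G) (I : csp_instance (@cost_arity R A G))
    (s : assignment A I) :
  0 <= vcsp_value s.
Proof.
apply: sumr_ge0 => C _; apply: mulr_ge0; first exact: ratr_weight_ge0.
by have /andP[] := hG _ (valP (symbol C)) (map_tuple s (scope C)).
Qed.

(** The two arities agree only up to a proof, hence the cast; once [r] is replaced by
    [zero_relation f], that proof is [erefl]. *)
Lemma cost_zero_relation (f : cost_function R A) (r : relation A) :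
    zero_relation f = r -> forall (e : tag r = tag f) (t : (tag r).-tuple A),
  (t \in tagged r) = (tagged f (tcast e t) == 0).
Proof. by move=> <- e t; rewrite inE (eq_irrelevance e erefl). Qed.

Lemma zero_relation_cost (f : cost_function R A) (r : relation A) :
    zero_relation f = r -> forall (e : tag f = tag r) (t : (tag f).-tuple A),
  (tcast e t \in tagged r) = (tagged f t == 0).
Proof. by move=> <- e t; rewrite (eq_irrelevance e erefl) inE. Qed.

Lemma map_tcast (T U : Type) (g : T -> U) m n (e : m = n) (t : m.-tuple T) :
  map_tuple g (tcast e t) = tcast e (map_tuple g t).
Proof. by case: n / e. Qed.

Lemma nonzero_cost_bounds (G : {fset cost_function R A}) :
    is_valued_language G ->
  exists2 e : R, 0 < e & forall (f : G) (t : (cost_arity f).-tuple A),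
  e * (tagged (val f) t != 0)%:R <= tagged (val f) t <= (tagged (val f) t != 0)%:R.
Proof.
(* Pairs of a cost function and a tuple form a finite type, so one [e] serves the whole language. *)
move=> hG; pose F (x : {f : G & (cost_arity f).-tuple A}) : R :=
  tagged (val (tag x)) (tagged x).
have [e e_gt0 le_e] := positive_values_bounded_below F; exists e => // f t.
have /andP[f_ge0 f_le1] := hG _ (valP f) t.
have [->|f_neq0] := eqVneq (tagged (val f) t) 0; first by rewrite mulr0 lexx.
rewrite /= mulr1 f_le1 andbT.
by apply: (le_e (Tagged (fun f : G => (cost_arity f).-tuple A) t)); rewrite lt0r f_neq0.
Qed.

End Values.

Theorem theorem4 (R : realType) (A : finType)
    (Gamma1 : {fset cost_function R A})
    (hGamma1 : is_valued_language Gamma1) :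
  APX (VCSP Gamma1) <-> APX (MinCSP R (zero_language Gamma1)).
Proof.
have [e e_gt0 e_bound] := nonzero_cost_bounds hGamma1.
split.
- have ex_f (r : zero_language Gamma1) :
      exists f : Gamma1, zero_relation (val f) == val r.
    by have /imfsetP[f /= fG ->] := valP r; exists [` fG]%fset.
  (* Several cost functions may share a zero relation; any choice works, as [e_bound] is uniform. *)
  pose phi r := xchoose (ex_f r).
  have phiE r : zero_relation (val (phi r)) = val r.
    exact/eqP/(xchooseP (ex_f r)).
  have ar_phi (r : zero_language Gamma1) : rel_arity r = cost_arity (phi r).
    by rewrite /rel_arity -phiE.
  (* A violated constraint costs at least [e] and at most [1] per unit of weight. *)
  apply: (@APX_relabel _ _ _ _ _ _ phi ar_phi _ _ e^-1 1).
  + by rewrite invr_ge0 ltW.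
  + exact: vcsp_value_ge0.
  + move=> I s; rewrite mincsp_valueE /vcsp_value /= big_map mulr_sumr.
    apply: ler_sum => C _; rewrite mulrCA ler_wpM2l ?ratr_weight_ge0 //=.
    rewrite ler_pdivlMl // (cost_zero_relation (phiE _) (ar_phi _)) map_tcast.
    by have /andP[] := e_bound _ (tcast (ar_phi (symbol C)) (map_tuple s (scope C))).
  + move=> I s; rewrite mul1r mincsp_valueE /vcsp_value /= big_map.
    apply: ler_sum => C _; rewrite ler_wpM2l ?ratr_weight_ge0 //=.
    rewrite (cost_zero_relation (phiE _) (ar_phi _)) map_tcast.
    by have /andP[] := e_bound _ (tcast (ar_phi (symbol C)) (map_tuple s (scope C))).
- have zeroP (f : Gamma1) : zero_relation (val f) \in zero_language Gamma1.
    by apply/imfsetP; exists (val f) => //; apply: valP.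
  pose phi (f : Gamma1) : zero_language Gamma1 := [` zeroP f]%fset.
  have ar_phi (f : Gamma1) : cost_arity f = rel_arity (phi f) by [].
  (* The same two bounds, with the roles of the problems exchanged. *)
  apply: (@APX_relabel _ _ _ _ _ _ phi ar_phi _ _ 1 e^-1) => //.
  + exact: mincsp_value_ge0.
  + move=> I s; rewrite mul1r mincsp_valueE /vcsp_value /= big_map.
    apply: ler_sum => C _; rewrite ler_wpM2l ?ratr_weight_ge0 //=.
    rewrite map_tcast (@zero_relation_cost _ _ (val (symbol C))) //.
    by have /andP[] := e_bound _ (map_tuple s (scope C)).
  + move=> I s; rewrite mincsp_valueE /vcsp_value /= big_map mulr_sumr.
    apply: ler_sum => C _; rewrite mulrCA ler_wpM2l ?ratr_weight_ge0 //=.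
    rewrite ler_pdivlMl // map_tcast (@zero_relation_cost _ _ (val (symbol C))) //.
    by have /andP[] := e_bound _ (map_tuple s (scope C)).
Qed.
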